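(* (In $\mathbf{ZF}$.) Every $G_\delta$-subspace of a Cantor completely metrizable space is Cantor completely metrizable.
   Context: The result is a theorem of $\mathbf{ZF}$ (Zermelo–Fraenkel set theory without the axiom of choice). For a metric $d$ on $X$, $\tau(d)$ is the topology induced by $d$ and $\delta_d(A)=\sup\{d(x,y):x,y\in A\}$. A metric $d$ on $X$ is Cantor complete if, for every descending family $\{F_n:n\in\omega\}$ of non-empty closed subsets of $\langle X,\tau(d)\rangle$ with $\lim_{n\to+\infty}\delta_d(F_n)=0$, we have $\bigcap_{n\in\omega}F_n\neq\emptyset$. A topological space $\langle X,\tau\rangle$ is Cantor completely metrizable if there is a Cantor complete metric $d$ on $X$ with $\tau=\tau(d)$. A $G_\delta$-subspace is a subspace whose underlying set is a countable intersection of open sets of the space. *)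

(* Defs.v *)
(* A theorem of ZF is a sentence true in every model of ZF (Goedel completeness).
   The result is stated in this form, since Rocq's own logic is not ZF and choice
   principles may be available in it: every quantifier of the statement ranges
   over the elements of an arbitrary model, and the axiom of choice is not assumed
   to hold in that model. *)

Set Implicit Arguments.

Record set_structure := SetStructure {
  dom :> Type;
  mem : dom -> dom -> Prop
}.

Notation "x ∈ y" := (mem _ x y) (at level 70, no associativity).

(* Variables are de Bruijn indices. *)
Inductive formula : Set :=
| fMem (i j : nat)
| fEq (i j : nat)
| fFalse
| fImp (a b : formula)
| fAnd (a b : formula)
| fOr (a b : formula)
| fAll (a : formula)
| fEx (a : formula).

Definition scons (T : Type) (x : T) (e : nat -> T) (n : nat) : T :=
  match n with O => x | S k => e k end.

Fixpoint sat (M : set_structure) (e : nat -> M) (a : formula) : Prop :=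
  match a with
  | fMem i j => e i ∈ e j
  | fEq i j => e i = e j
  | fFalse => False
  | fImp a b => sat M e a -> sat M e b
  | fAnd a b => sat M e a /\ sat M e b
  | fOr a b => sat M e a \/ sat M e b
  | fAll a => forall x : M, sat M (scons x e) a
  | fEx a => exists x : M, sat M (scons x e) a
  end.

Section SetTheory.
Context {M : set_structure}.
Implicit Types A B C F G K P R S T U V X Y a b c d e f m n p r s t u v w x y z : M.

Definition subset x y := forall z, z ∈ x -> z ∈ y.
Definition is_empty x := forall z, ~ z ∈ x.
Definition nonempty x := exists z, z ∈ x.
Definition is_upair p x y := forall z, z ∈ p <-> z = x \/ z = y.
Definition is_succ y x := forall z, z ∈ y <-> z ∈ x \/ z = x.
Definition is_inductive w :=
  (exists z, z ∈ w /\ is_empty z) /\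
  (forall x, x ∈ w -> exists y, y ∈ w /\ is_succ y x).

End SetTheory.

(* In the two schemes, the values of the assignment e other than those for the
   distinguished variables are the parameters. *)
Record is_ZF_model (M : set_structure) : Prop := {
  zf_extensionality :
    forall x y : M, (forall z : M, z ∈ x <-> z ∈ y) -> x = y;
  zf_foundation :
    forall x : M, nonempty x ->
      exists y : M, y ∈ x /\ ~ (exists z : M, z ∈ y /\ z ∈ x);
  zf_pairing :
    forall x y : M, exists p : M, is_upair p x y;
  zf_union :
    forall x : M, exists u : M,
      forall z : M, z ∈ u <-> exists y : M, y ∈ x /\ z ∈ y;
  zf_power :
    forall x : M, exists p : M, forall z : M, z ∈ p <-> subset z x;
  zf_infinity :
    exists w : M, is_inductive w;
  zf_separation :
    forall (a : formula) (e : nat -> M) (x : M), exists y : M,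
      forall z : M, z ∈ y <-> z ∈ x /\ sat M (scons z e) a;
  zf_replacement :
    forall (a : formula) (e : nat -> M) (x : M),
      (forall u v v' : M, u ∈ x ->
         sat M (scons u (scons v e)) a -> sat M (scons u (scons v' e)) a ->
         v = v') ->
      exists y : M, forall v : M,
        v ∈ y <-> exists u : M, u ∈ x /\ sat M (scons u (scons v e)) a
}.

Section Notions.
Context {M : set_structure}.
Implicit Types A B C F G K P R S T U V X Y a b c d e f m n p r s t u v w x y z : M.

Definition is_omega w :=
  is_inductive w /\ forall v, is_inductive v -> subset w v.

(* Kuratowski pair: p = {{x}, {x, y}}. *)
Definition is_pair p x y :=
  forall z, z ∈ p <-> is_upair z x x \/ is_upair z x y.

Definition is_product P A B :=
  forall p, p ∈ P <-> exists a b, a ∈ A /\ b ∈ B /\ is_pair p a b.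

Definition related f x y := exists p, p ∈ f /\ is_pair p x y.

Definition is_function_on f A :=
  (forall p, p ∈ f -> exists a b, a ∈ A /\ is_pair p a b) /\
  (forall a, a ∈ A -> exists! b, related f a b).

Definition is_function f A B :=
  is_function_on f A /\ forall a b, related f a b -> b ∈ B.

Definition is_function2 f A B C :=
  exists P, is_product P A B /\ is_function f P C.

Definition maps2 f x y z := exists p, is_pair p x y /\ related f p z.

Record field_data := FieldData {
  fcarrier : M;
  fadd : M;
  fmul : M;
  fzero : M;
  fone : M;
  fle : M
}.

Definition rle (K : field_data) x y := related (fle K) x y.
Definition rlt (K : field_data) x y := rle K x y /\ x <> y.

Definition is_lub (K : field_data) (Q : M -> Prop) s :=
  s ∈ fcarrier K /\
  (forall x, Q x -> rle K x s) /\
  (forall b, b ∈ fcarrier K -> (forall x, Q x -> rle K x b) -> rle K s b).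

(* The real line is axiomatized as a complete ordered field; it exists and is
   unique up to isomorphism in ZF. *)
Record is_real_line (K : field_data) : Prop := {
  rl_add : is_function2 (fadd K) (fcarrier K) (fcarrier K) (fcarrier K);
  rl_mul : is_function2 (fmul K) (fcarrier K) (fcarrier K) (fcarrier K);
  rl_zero : fzero K ∈ fcarrier K;
  rl_one : fone K ∈ fcarrier K;
  rl_zero_neq_one : fzero K <> fone K;
  rl_addA : forall x y z u v t,
    x ∈ fcarrier K -> y ∈ fcarrier K -> z ∈ fcarrier K ->
    maps2 (fadd K) x y u -> maps2 (fadd K) y z v ->
    maps2 (fadd K) u z t -> maps2 (fadd K) x v t;
  rl_addC : forall x y u,
    x ∈ fcarrier K -> y ∈ fcarrier K ->
    maps2 (fadd K) x y u -> maps2 (fadd K) y x u;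
  rl_add0 : forall x, x ∈ fcarrier K -> maps2 (fadd K) x (fzero K) x;
  rl_addN : forall x, x ∈ fcarrier K ->
    exists y, y ∈ fcarrier K /\ maps2 (fadd K) x y (fzero K);
  rl_mulA : forall x y z u v t,
    x ∈ fcarrier K -> y ∈ fcarrier K -> z ∈ fcarrier K ->
    maps2 (fmul K) x y u -> maps2 (fmul K) y z v ->
    maps2 (fmul K) u z t -> maps2 (fmul K) x v t;
  rl_mulC : forall x y u,
    x ∈ fcarrier K -> y ∈ fcarrier K ->
    maps2 (fmul K) x y u -> maps2 (fmul K) y x u;
  rl_mul1 : forall x, x ∈ fcarrier K -> maps2 (fmul K) x (fone K) x;
  rl_mulV : forall x, x ∈ fcarrier K -> x <> fzero K ->
    exists y, y ∈ fcarrier K /\ maps2 (fmul K) x y (fone K);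
  rl_mulD : forall x y z s u v t,
    x ∈ fcarrier K -> y ∈ fcarrier K -> z ∈ fcarrier K ->
    maps2 (fadd K) y z s -> maps2 (fmul K) x y u -> maps2 (fmul K) x z v ->
    maps2 (fadd K) u v t -> maps2 (fmul K) x s t;
  rl_le_refl : forall x, x ∈ fcarrier K -> rle K x x;
  rl_le_anti : forall x y, x ∈ fcarrier K -> y ∈ fcarrier K ->
    rle K x y -> rle K y x -> x = y;
  rl_le_trans : forall x y z,
    x ∈ fcarrier K -> y ∈ fcarrier K -> z ∈ fcarrier K ->
    rle K x y -> rle K y z -> rle K x z;
  rl_le_total : forall x y, x ∈ fcarrier K -> y ∈ fcarrier K ->
    rle K x y \/ rle K y x;
  rl_le_add : forall x y z u v,
    x ∈ fcarrier K -> y ∈ fcarrier K -> z ∈ fcarrier K -> rle K x y ->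
    maps2 (fadd K) x z u -> maps2 (fadd K) y z v -> rle K u v;
  rl_le_mul : forall x y u,
    x ∈ fcarrier K -> y ∈ fcarrier K ->
    rle K (fzero K) x -> rle K (fzero K) y ->
    maps2 (fmul K) x y u -> rle K (fzero K) u;
  rl_complete : forall S,
    subset S (fcarrier K) -> nonempty S ->
    (exists b, b ∈ fcarrier K /\ forall x, x ∈ S -> rle K x b) ->
    exists s, is_lub K (fun x => x ∈ S) s
}.

Record is_topology X T : Prop := {
  top_subset : forall U, U ∈ T -> subset U X;
  top_empty : forall U, is_empty U -> U ∈ T;
  top_full : X ∈ T;
  top_union : forall A U, subset A T ->
    (forall x, x ∈ U <-> exists V, V ∈ A /\ x ∈ V) -> U ∈ T;
  top_inter : forall U V G, U ∈ T -> V ∈ T ->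
    (forall x, x ∈ G <-> x ∈ U /\ x ∈ V) -> G ∈ T
}.

Definition is_closed X T F :=
  subset F X /\
  exists U, U ∈ T /\ forall x, x ∈ U <-> x ∈ X /\ ~ x ∈ F.

Definition is_subspace_topology T Y V :=
  forall A, A ∈ V <-> exists U, U ∈ T /\ forall x, x ∈ A <-> x ∈ U /\ x ∈ Y.

Definition is_Gdelta w T Y :=
  exists U, is_function U w T /\
    forall x, x ∈ Y <-> forall n A, n ∈ w -> related U n A -> x ∈ A.

Record is_metric (K : field_data) X d : Prop := {
  met_fun : is_function2 d X X (fcarrier K);
  met_nonneg : forall x y r, x ∈ X -> y ∈ X ->
    maps2 d x y r -> rle K (fzero K) r;
  met_zero : forall x y, x ∈ X -> y ∈ X ->
    (maps2 d x y (fzero K) <-> x = y);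
  met_sym : forall x y r, x ∈ X -> y ∈ X -> maps2 d x y r -> maps2 d y x r;
  met_triangle : forall x y z r s t u, x ∈ X -> y ∈ X -> z ∈ X ->
    maps2 d x y r -> maps2 d y z s -> maps2 d x z t ->
    maps2 (fadd K) r s u -> rle K t u
}.

(* T = tau(d): the members of T are the sets U included in X which contain,
   around each of their points x, an open ball of radius r > 0. *)
Definition is_metric_topology (K : field_data) X d T :=
  forall U, U ∈ T <->
    subset U X /\
    forall x, x ∈ U -> exists r, r ∈ fcarrier K /\ rlt K (fzero K) r /\
      forall y s, y ∈ X -> maps2 d x y s -> rlt K s r -> y ∈ U.

(* The diameter of A is finite and equal to r. *)
Definition is_diameter (K : field_data) d A r :=
  is_lub K (fun s => exists x y, x ∈ A /\ y ∈ A /\ maps2 d x y s) r.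

(* Diameters take values in [0, +oo], so the limit is 0 exactly when they are
   eventually finite and smaller than any given e > 0. *)
Definition diameters_tend_to_zero w (K : field_data) d F :=
  forall e, e ∈ fcarrier K -> rlt K (fzero K) e ->
    exists m, m ∈ w /\
      forall n A, n ∈ w -> m = n \/ m ∈ n -> related F n A ->
        exists r, is_diameter K d A r /\ rlt K r e.

Definition is_Cantor_complete w (K : field_data) X d :=
  is_metric K X d /\
  forall T F,
    is_metric_topology K X d T ->
    is_function_on F w ->
    (forall n A, n ∈ w -> related F n A -> nonempty A /\ is_closed X T A) ->
    (forall m n A B, m ∈ w -> n ∈ w -> m ∈ n ->
       related F m A -> related F n B -> subset B A) ->
    diameters_tend_to_zero w K d F ->
    exists x, forall n A, n ∈ w -> related F n A -> x ∈ A.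

Definition is_Cantor_completely_metrizable w (K : field_data) X T :=
  is_topology X T /\
  exists d, is_Cantor_complete w K X d /\ is_metric_topology K X d T.

End Notions.

Arguments field_data M : clear implicits.

(* Main.v *)
From HB Require Import structures.
From mathcomp Require Import all_boot all_order all_algebra.
From mathcomp Require Import boolp.
From mathcomp Require Import ring lra.
Require Import Defs.
Import Order.TTheory GRing.Theory Num.Theory.

Set Implicit Arguments.
Unset Strict Implicit.
Unset Printing Implicit Defensive.

(** Let d be a Cantor complete metric on X, and Y the intersection of the open
sets U_n. For x in U_n let f_n(x) be the inverse of the distance from x to the
complement of U_n (0 if that complement is empty). The metric on Y is
<<
  rho(x, y) = sup ({d(x, y)} + {min (2^-n, |f_n(x) - f_n(y)|) : n in omega}).
>>
A supremum is used here, not the customary series, and neither f_n nor the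
supremum over n is ever formed: [near x y t] expresses rho(x, y) <= t by a
formula in which only balls occur, a triangle inequality for [near] is immediate
([near_trans]), and rho(x, y) is the least t with [near x y t] ([near_min]).

The metric rho induces the subspace topology, because d <= rho and, conversely,
small d-balls around a point of Y are contained in any given rho-ball
([rho_continuous]): only the finitely many n with 2^-n > t matter for
rho(x, y) <= t, and each f_n is continuous on U_n ([ctrl_continuous]).

For Cantor completeness ([rho_complete]), let G_n be a descending sequence of
non-empty rho-closed sets whose rho-diameters tend to 0. Their closures in X
satisfy the same assumptions for d, so they have a common point x. For every n,
some G_m has rho-diameter less than 2^-n; so f_n is bounded on G_m, say by c, the
balls of radius 1/c around the points of G_m are contained in U_n, and one of
them contains x. Therefore x is in Y, and then x is in every G_n because G_n is
closed in Y. No choice is made anywhere: the sequence of closures is definable.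

All this takes place in a model of ZF, so each set which is introduced must be
given by a formula with parameters. The predicate [dfn] says that a property of
assignments is given by such a formula; its closure properties let the tactic
[dfn] discharge these obligations. The real line of the model is presented
as an ordered field F ([real_presentation]) which is complete for definable
subsets ([lub_ex]). Choice in the meta-theory only names elements of the model
which are already known to exist. *)

(** * Definability with parameters *)

(** Renaming of the free variables of a formula along [f]. *)
Fixpoint ren (f : nat -> nat) (a : formula) : formula :=
  let up n := if n is k.+1 then (f k).+1 else 0 in
  match a with
  | fMem i j => fMem (f i) (f j)
  | fEq i j => fEq (f i) (f j)
  | fFalse => fFalse
  | fImp a b => fImp (ren f a) (ren f b)
  | fAnd a b => fAnd (ren f a) (ren f b)
  | fOr a b => fOr (ren f a) (ren f b)
  | fAll a => fAll (ren up a)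
  | fEx a => fEx (ren up a)
  end.

Lemma sat_ren (M : set_structure) a (f : nat -> nat) (e e' : nat -> M) :
  (forall n, e' n = e (f n)) -> sat M e (ren f a) <-> sat M e' a.
Proof.
elim: a f e e' => /=.
- by move=> i j f e e' E; rewrite !E.
- by move=> i j f e e' E; rewrite !E.
- by [].
- by move=> a IHa b IHb f e e' E; rewrite (IHa f e e' E) (IHb f e e' E).
- by move=> a IHa b IHb f e e' E; rewrite (IHa f e e' E) (IHb f e e' E).
- by move=> a IHa b IHb f e e' E; rewrite (IHa f e e' E) (IHb f e e' E).
- move=> a IHa f e e' E; split=> H x.
    by rewrite -IHa; [exact: (H x) | case=> [|n] /=].
  by rewrite IHa; [exact: (H x) | case=> [|n] /=].
- move=> a IHa f e e' E; split=> -[x H]; exists x.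
    by rewrite -IHa; [exact: H | case=> [|n] /=].
  by rewrite IHa; [exact: H | case=> [|n] /=].
Qed.

Section Definability.
Variables (M : set_structure) (c0 : M).
Implicit Types (P : (nat -> M) -> Prop) (t : (nat -> M) -> M).

(** Assignments are interleaved with parameters: even variables hold the former,
odd variables the latter. *)
Definition mix (T : Type) (e p : nat -> T) (n : nat) : T :=
  if odd n then p n./2 else e n./2.

Lemma mix_even T (e p : nat -> T) n : mix e p n.*2 = e n.
Proof. by rewrite /mix odd_double doubleK. Qed.

Lemma mix_odd T (e p : nat -> T) n : mix e p n.*2.+1 = p n.
Proof. by rewrite /mix /= odd_double /= uphalf_double. Qed.

Variant half_spec : nat -> Type :=
  | HalfEven n : half_spec n.*2
  | HalfOdd n : half_spec n.*2.+1.

Lemma halfP n : half_spec n.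
Proof. by rewrite -[n]odd_double_half; case: (odd n); constructor. Qed.

(** The property [P] of assignments is definable by a formula with parameters. *)
Definition dfn P := exists a (p : nat -> M),
  forall e, sat M (mix e p) a <-> P e.

Lemma dfn_ext P Q : (forall e, P e <-> Q e) -> dfn P -> dfn Q.
Proof. by move=> E [a [p H]]; exists a, p => e; rewrite H E. Qed.

Lemma dfn_ren P (f : nat -> nat) : dfn P -> dfn (fun e => P (fun n => e (f n))).
Proof.
move=> [a [p H]]; exists (ren (mix (fun n => (f n).*2) (fun n => n.*2.+1)) a), p.
move=> e; rewrite -H; apply: sat_ren => n; case: (halfP n) => {}n; last by rewrite !mix_odd.
by rewrite !mix_even.
Qed.

(** Two definable properties can be defined with the same parameters. *)
Lemma dfn_pair P Q : dfn P -> dfn Q -> exists a b p,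
  (forall e, sat M (mix e p) a <-> P e) /\ (forall e, sat M (mix e p) b <-> Q e).
Proof.
move=> [a [p H]] [b [q G]].
exists (ren (mix (fun n => n.*2) (fun n => n.*2.*2.+1)) a).
exists (ren (mix (fun n => n.*2) (fun n => n.*2.+1.*2.+1)) b), (mix p q).
split=> e; rewrite -?H -?G; apply: sat_ren => n; case: (halfP n) => {}n.
- by rewrite !mix_even.
- by rewrite !mix_odd mix_even.
- by rewrite !mix_even.
- by rewrite !mix_odd.
Qed.

Lemma dfn_and P Q : dfn P -> dfn Q -> dfn (fun e => P e /\ Q e).
Proof.
move=> dP dQ; have [a [b [p [H G]]]] := dfn_pair dP dQ.
by exists (fAnd a b), p => e /=; rewrite H G.
Qed.

Lemma dfn_or P Q : dfn P -> dfn Q -> dfn (fun e => P e \/ Q e).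
Proof.
move=> dP dQ; have [a [b [p [H G]]]] := dfn_pair dP dQ.
by exists (fOr a b), p => e /=; rewrite H G.
Qed.

Lemma dfn_imp P Q : dfn P -> dfn Q -> dfn (fun e => P e -> Q e).
Proof.
move=> dP dQ; have [a [b [p [H G]]]] := dfn_pair dP dQ.
by exists (fImp a b), p => e /=; rewrite H G.
Qed.

Lemma dfn_const (P : Prop) : dfn (fun _ => P).
Proof.
have [HP|HP] := pselect P.
  by exists (fImp fFalse fFalse), (fun _ => c0) => e; split=> // _ /=.
by exists fFalse, (fun _ => c0) => e; split.
Qed.

Lemma dfn_not P : dfn P -> dfn (fun e => ~ P e).
Proof. by move=> dP; apply: dfn_imp => //; exact: dfn_const. Qed.

Lemma dfn_iff P Q : dfn P -> dfn Q -> dfn (fun e => P e <-> Q e).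
Proof. by move=> dP dQ; apply: dfn_and; apply: dfn_imp. Qed.

(** The variables of [mix (scons x e) p], as variables of [scons x (mix e p)]. *)
Definition under_binder n :=
  mix (fun n => if n is k.+1 then k.*2.+1 else 0) (fun n => n.*2.+2) n.

Lemma under_binderE (x : M) e p n :
  mix (scons x e) p n = scons x (mix e p) (under_binder n).
Proof.
rewrite /under_binder; case: (halfP n) => {}n; last by rewrite !mix_odd /= mix_odd.
by rewrite !mix_even; case: n => [|n] //=; rewrite mix_even.
Qed.

Lemma dfn_all (Q : M -> (nat -> M) -> Prop) :
  dfn (fun e => Q (e 0) (fun n => e n.+1)) -> dfn (fun e => forall x, Q x e).
Proof.
move=> [a [p H]]; exists (fAll (ren under_binder a)), p => e /=.
by split=> G x; have := G x; rewrite (sat_ren a (under_binderE x e p)) (H (scons x e)).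
Qed.

Lemma dfn_ex (Q : M -> (nat -> M) -> Prop) :
  dfn (fun e => Q (e 0) (fun n => e n.+1)) -> dfn (fun e => exists x, Q x e).
Proof.
move=> [a [p H]]; exists (fEx (ren under_binder a)), p => e /=.
by split=> -[x G]; exists x; move: G; rewrite (sat_ren a (under_binderE x e p)) (H (scons x e)).
Qed.

(** The term [t] is definable: its graph is, variable 0 standing for the value and
the assignment of [t] being shifted by one. *)
Definition dterm t := dfn (fun e => t (fun n => e n.+1) = e 0).

Lemma dterm_var i : dterm (fun e => e i).
Proof.
exists (fEq i.+1.*2 0), (fun _ => c0) => e.
by rewrite /sat mix_even (mix_even e _ 0).
Qed.

Lemma dterm_const (c : M) : dterm (fun _ => c).
Proof.
exists (fEq 1 0), (fun _ => c) => e.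
by rewrite /sat (mix_odd e _ 0) (mix_even e _ 0).
Qed.

(** Substitution of a definable term. *)
Lemma dfn_sub t (Q : M -> (nat -> M) -> Prop) : dterm t ->
  dfn (fun e => Q (e 0) (fun n => e n.+1)) -> dfn (fun e => Q (t e) e).
Proof.
move=> dt dQ; apply: (@dfn_ext (fun e => exists x, t e = x /\ Q x e)).
  by move=> e; split=> [[x [<-]]|H] //; exists (t e).
by apply: dfn_ex; apply: dfn_and.
Qed.

Lemma dterm_weak t : dterm t -> dterm (fun e => t (fun n => e n.+1)).
Proof. exact: (@dfn_ren _ (fun n => if n is k.+1 then k.+2 else 0)). Qed.

Lemma dfn_sub2 t s (Q : M -> M -> Prop) : dterm t -> dterm s ->
  dfn (fun e => Q (e 0) (e 1)) -> dfn (fun e => Q (t e) (s e)).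
Proof.
move=> dt ds dQ; apply: (@dfn_sub t (fun x e => Q x (s e)) dt).
apply: (@dfn_sub (fun e => s (fun n => e n.+1)) (fun y e => Q (e 0) y)).
  exact: dterm_weak.
exact: (dfn_ren (fun n => if n is 0 then 1 else 0) dQ).
Qed.

Lemma dfn_mem t s : dterm t -> dterm s -> dfn (fun e => t e ∈ s e).
Proof.
move=> dt ds; apply: (@dfn_sub2 t s (fun x y => x ∈ y)) => //.
exists (fMem 0 2), (fun _ => c0) => e.
by rewrite /sat (mix_even e _ 0) (mix_even e _ 1).
Qed.

Lemma dfn_eq t s : dterm t -> dterm s -> dfn (fun e => t e = s e).
Proof.
move=> dt ds; apply: (@dfn_sub2 t s (fun x y => x = y)) => //.
exists (fEq 0 2), (fun _ => c0) => e.
by rewrite /sat (mix_even e _ 0) (mix_even e _ 1).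
Qed.

(** Operations with a definable graph take definable terms to definable terms. *)
Lemma dterm_op2 (h : M -> M -> M) t s :
  dfn (fun e => h (e 1) (e 2) = e 0) -> dterm t -> dterm s ->
  dterm (fun e => h (t e) (s e)).
Proof.
move=> dh dt ds.
apply: (@dfn_sub (fun e => t (fun n => e n.+1))
  (fun x e => h x (s (fun n => e n.+1)) = e 0)); first exact: dterm_weak.
apply: (@dfn_sub (fun e => s (fun n => e n.+2)) (fun y e => h (e 0) y = e 1)).
  exact: (dterm_weak (dterm_weak ds)).
exact: (dfn_ren (fun n => match n with 0 => 2 | 1 => 1 | _ => 0 end) dh).
Qed.

Lemma dterm_op1 (h : M -> M) t :
  dfn (fun e => h (e 1) = e 0) -> dterm t -> dterm (fun e => h (t e)).
Proof.
by move=> dh dt; apply: (@dterm_op2 (fun x _ => h x) t t).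
Qed.

End Definability.

Section Model.
Variables (M : set_structure) (hM : is_ZF_model M).
Variables (w : M) (hw : is_omega w).

(** * Elementary set theory in the model *)

(** Some element satisfying [P], and the arbitrary element [w] if there is none. *)
Definition the (P : M -> Prop) : M :=
  if pselect (exists y, P y) is left h then projT1 (cid h) else w.

Lemma theP (P : M -> Prop) : (exists y, P y) -> P (the P).
Proof. by rewrite /the; case: pselect => // h _; case: (cid h). Qed.

Lemma ext (x y : M) : (forall z, z ∈ x <-> z ∈ y) -> x = y.
Proof. exact: zf_extensionality. Qed.

(** The set of the elements of [A] with property [Q], provided that [Q] is
definable. *)
Definition sep (A : M) (Q : M -> Prop) : M :=
  the (fun y => forall z, z ∈ y <-> z ∈ A /\ Q z).

Lemma sepE A (Q : M -> Prop) : dfn (fun e => Q (e 0)) ->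
  forall z, z ∈ sep A Q <-> z ∈ A /\ Q z.
Proof.
move=> [a [p H]]; apply: (@theP (fun y => forall z, z ∈ y <-> z ∈ A /\ Q z)).
have [y Hy] := zf_separation hM (ren under_binder a) (mix (fun=> w) p) A.
exists y => z; rewrite Hy.
by rewrite (sat_ren a (under_binderE z (fun=> w) p)) (H (scons z (fun=> w))).
Qed.

(** The unordered pair. *)
Definition up (x y : M) : M := the (fun p => is_upair p x y).

Lemma upE x y z : z ∈ up x y <-> z = x \/ z = y.
Proof. by move: z; apply: (@theP (fun p => is_upair p x y)); apply: zf_pairing. Qed.

Lemma is_upairE p x y : is_upair p x y <-> up x y = p.
Proof.
split=> [H|<-]; last by move=> z; exact: upE.
by apply: ext => z; rewrite upE H.
Qed.

(** The Kuratowski pair. *)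
Definition pr (x y : M) : M := up (up x x) (up x y).

Lemma is_pairE p x y : is_pair p x y <-> pr x y = p.
Proof.
split=> [H|<-].
  by apply: ext => z; rewrite upE H !is_upairE; split=> -[] ->; tauto.
by move=> z; rewrite upE !is_upairE; split=> -[] ->; tauto.
Qed.

Lemma up_inj x y x' y' : up x y = up x' y' ->
  (x = x' /\ y = y') \/ (x = y' /\ y = x').
Proof.
move=> E; have H z : z = x \/ z = y -> z = x' \/ z = y' by rewrite -!upE E.
have H' z : z = x' \/ z = y' -> z = x \/ z = y by rewrite -!upE E.
have Hx := H x (or_introl erefl); have Hy := H y (or_intror erefl).
have Hx' := H' x' (or_introl erefl); have Hy' := H' y' (or_intror erefl).
by case: Hx => ?; case: Hy => ?; case: Hx' => ?; case: Hy' => ?; subst; auto.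
Qed.

Lemma pr_inj x y x' y' : pr x y = pr x' y' -> x = x' /\ y = y'.
Proof.
by move=> /up_inj[] [] /up_inj[] [? ?] /up_inj[] [? ?]; subst.
Qed.

Lemma relatedE f x y : related f x y <-> pr x y ∈ f.
Proof.
by split=> [[p [pf /is_pairE ->]]|H] //; exists (pr x y); split=> //; apply/is_pairE.
Qed.

Lemma maps2E f x y z : maps2 f x y z <-> pr (pr x y) z ∈ f.
Proof.
split=> [[p [/is_pairE -> /relatedE]]|H] //; exists (pr x y).
by split; [apply/is_pairE | apply/relatedE].
Qed.

Definition power (x : M) : M := the (fun p => forall z, z ∈ p <-> subset z x).

Lemma powerE x z : z ∈ power x <-> subset z x.
Proof.
move: z; apply: (@theP (fun p => forall z, z ∈ p <-> subset z x)).
exact: zf_power.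
Qed.

Definition bigcup (x : M) : M :=
  the (fun u => forall z, z ∈ u <-> exists y, y ∈ x /\ z ∈ y).

Lemma bigcupE x z : z ∈ bigcup x <-> exists y, y ∈ x /\ z ∈ y.
Proof.
move: z.
apply: (@theP (fun u => forall z, z ∈ u <-> exists y, y ∈ x /\ z ∈ y)).
exact: zf_union.
Qed.

Definition cup (x y : M) : M := bigcup (up x y).

Lemma cupE x y z : z ∈ cup x y <-> z ∈ x \/ z ∈ y.
Proof.
rewrite bigcupE; split=> [[u [/upE[] -> H]]|[] H]; first by left.
- by right.
- by exists x; rewrite upE; tauto.
- by exists y; rewrite upE; tauto.
Qed.

Definition suc (x : M) : M := cup x (up x x).

Lemma is_succE y x : is_succ y x <-> suc x = y.
Proof.
split=> [H|<-]; last by move=> z; rewrite cupE upE; tauto.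
by apply: ext => z; rewrite cupE upE H; tauto.
Qed.

(** ** Automation of definability *)

Lemma dterm_up t s : dterm t -> dterm s -> dterm (fun e => up (t e) (s e)).
Proof.
apply: (@dterm_op2 _ up).
apply: (@dfn_ext _ (fun e => forall z, z ∈ e 0 <-> z = e 1 \/ z = e 2)).
  by move=> e; exact: is_upairE.
apply: dfn_all; apply: dfn_iff; last apply: dfn_or.
- by apply: (dfn_mem w); apply: (dterm_var w).
- by apply: (dfn_eq w); apply: (dterm_var w).
- by apply: (dfn_eq w); apply: (dterm_var w).
Qed.

(* The hooks [dfn_user] and [dterm_user] are redefined as notions are added. *)
Ltac dfn_user := fail.
Ltac dterm_user := fail.
Ltac dfn_step := lazy beta;
  match goal with
  | |- dterm _ =>
    first [apply dterm_const | apply (dterm_var w) | assumption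
          | apply dterm_up | dterm_user]
  | |- dfn (fun e => is_empty (@?a e)) => unfold is_empty
  | |- dfn (fun e => is_succ (@?a e) (@?b e)) => unfold is_succ
  | |- dfn _ =>
    first [apply (dfn_const w) | assumption | dfn_user
          | apply dfn_iff | apply dfn_and | apply dfn_or | apply (dfn_not w)
          | apply dfn_imp | apply dfn_all | apply dfn_ex
          | apply (dfn_mem w) | apply (dfn_eq w)]
  end.
Ltac dfn := repeat dfn_step.

Lemma dterm_suc t : dterm t -> dterm (fun e => suc (t e)).
Proof.
apply: (@dterm_op1 _ suc).
apply: (@dfn_ext _ (fun e => is_succ (e 0) (e 1))); last by dfn.
by move=> e; exact: is_succE.
Qed.

Lemma dterm_pr t s : dterm t -> dterm s -> dterm (fun e => pr (t e) (s e)).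
Proof. by move=> dt ds; rewrite /pr; dfn. Qed.

Ltac dterm_user ::= first [apply dterm_suc | apply dterm_pr].

Definition prod (A B : M) : M :=
  sep (power (power (cup A B)))
      (fun p => exists a b, a ∈ A /\ b ∈ B /\ p = pr a b).

Lemma prodE A B p : p ∈ prod A B <-> exists a b, a ∈ A /\ b ∈ B /\ p = pr a b.
Proof.
rewrite sepE; last by dfn.
split=> [[]|[a [b [aA [bB ->]]]]] //; split; last by exists a, b.
apply/powerE => z /upE[] -> //; apply/powerE => u /upE[] ->; rewrite cupE; tauto.
Qed.

Lemma pr_prod A B a b : pr a b ∈ prod A B <-> a ∈ A /\ b ∈ B.
Proof.
rewrite prodE; split=> [[x [y [xA [yB /pr_inj[-> ->]]]]]|[aA bB]] //.
by exists a, b.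
Qed.

Lemma is_productE P A B : is_product P A B <-> P = prod A B.
Proof.
have H p : (exists a b, a ∈ A /\ b ∈ B /\ is_pair p a b) <-> p ∈ prod A B.
  by rewrite prodE; split=> -[a [b [aA [bB E]]]]; exists a, b;
     move: E; rewrite is_pairE => <-.
split=> [E|-> p]; last by rewrite H.
by apply: ext => p; rewrite E H.
Qed.

(** A binary function from [A] and [B] to [C] in the model, read as a
single-valued total relation. *)
Lemma function2P (f A B C : M) : is_function2 f A B C ->
  [/\ forall x y, x ∈ A -> y ∈ B -> exists z, maps2 f x y z,
      forall x y z, maps2 f x y z -> [/\ x ∈ A, y ∈ B & z ∈ C] &
      forall x y z z', maps2 f x y z -> maps2 f x y z' -> z = z'].
Proof.
move=> [P [/is_productE -> [[Hdom Hfun] Hcod]]].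
have D x y z : maps2 f x y z -> [/\ x ∈ A, y ∈ B & z ∈ C].
  rewrite maps2E => H.
  have [a [b [aP /is_pairE /pr_inj[E ?]]]] := Hdom _ H.
  subst a b; move: aP; rewrite pr_prod => -[xA yB]; split=> //.
  by apply: (Hcod (pr x y)); rewrite relatedE.
split=> //.
- move=> x y xA yB; have [|z [/relatedE H _]] := Hfun (pr x y).
    by rewrite pr_prod.
  by exists z; rewrite maps2E.
- move=> x y z z' H H'; have [xA yB _] := D _ _ _ H.
  have [|u [_ Hu]] := Hfun (pr x y); first by rewrite pr_prod.
  by transitivity u; [apply: esym|]; apply: Hu; rewrite relatedE -maps2E.
Qed.

(** The restriction of a definable ternary relation to [A], [B] and [C], as a
binary function in the model when the relation is functional. *)
Definition graph2 (A B C : M) (R : M -> M -> M -> Prop) : M :=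
  sep (prod (prod A B) C) (fun p => exists x y z, p = pr (pr x y) z /\ R x y z).

Lemma graph2E A B C R : dfn (fun e => R (e 0) (e 1) (e 2)) ->
  forall x y z, maps2 (graph2 A B C R) x y z <->
    [/\ x ∈ A, y ∈ B & z ∈ C] /\ R x y z.
Proof.
move=> dR x y z; rewrite maps2E sepE.
  rewrite !pr_prod; split=> [[[[? ?] ?]]|[[? ? ?] ?]] //.
    by move=> [x' [y' [z' [/pr_inj[/pr_inj[<- <-] <-]]]]].
  by split=> //; exists x, y, z.
dfn; exact: (dfn_ren (fun n => match n with 0 => 2 | 1 => 1 | _ => 0 end) dR).
Qed.

Lemma graph2_function A B C R : dfn (fun e => R (e 0) (e 1) (e 2)) ->
  (forall x y, x ∈ A -> y ∈ B -> exists z, z ∈ C /\ R x y z) ->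
  (forall x y z z', R x y z -> R x y z' -> z = z') ->
  is_function2 (graph2 A B C R) A B C.
Proof.
move=> dR tot uniq; exists (prod A B); split; first exact/is_productE.
have G := graph2E A B C dR; split; first split.
- move=> p; rewrite sepE.
    by move=> [/prodE [a [b [aA [bB ->]]]] _]; exists a, b; rewrite is_pairE.
  dfn; exact: (dfn_ren (fun n => match n with 0 => 2 | 1 => 1 | _ => 0 end) dR).
- move=> p /prodE [x [y [xA [yB ->]]]]; have [z [zC Rz]] := tot x y xA yB.
  exists z; split; first by rewrite relatedE -maps2E G.
  by move=> z'; rewrite relatedE -maps2E G => -[_]; exact: uniq.
- move=> p z; rewrite relatedE sepE.
    by move=> [/prodE [? [? [_ [H /pr_inj[_ ->]]]]]].
  dfn; exact: (dfn_ren (fun n => match n with 0 => 2 | 1 => 1 | _ => 0 end) dR).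
Qed.

(** * The real line as an ordered field *)

Variables (K : field_data M) (hK : is_real_line K).

(** A presentation of the real line [K] of the model by an ordered field [F]:
the order and the operations of [F] are those of [K], but [F] is complete only
with respect to the subsets of [K] in the model. *)
Record presentation := Presentation {
  rF : realFieldType;
  rv : rF -> M;
  rv_inj : injective rv;
  rv_in : forall a, rv a ∈ fcarrier K;
  rv_surj : forall x, x ∈ fcarrier K -> exists a, rv a = x;
  rv_0 : rv 0%R = fzero K;
  rv_1 : rv 1%R = fone K;
  rv_add : forall a b z, maps2 (fadd K) (rv a) (rv b) z <-> rv (a + b)%R = z;
  rv_mul : forall a b z, maps2 (fmul K) (rv a) (rv b) z <-> rv (a * b)%R = z;
  rv_le : forall a b, rle K (rv a) (rv b) <-> (a <= b)%R
}.

Section Field.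
Local Open Scope ring_scope.

(** The elements of the real line, as a type. *)
Definition Rt := {x : M | x ∈ fcarrier K}.
HB.instance Definition _ := gen_eqMixin Rt.
HB.instance Definition _ := gen_choiceMixin Rt.
Let mkRt x (h : x ∈ fcarrier K) : Rt := exist (fun x => x ∈ fcarrier K) x h.
Let rt (a : Rt) : M := proj1_sig a.
Let rtP (a : Rt) : rt a ∈ fcarrier K := proj2_sig a.

Let rt_inj (a b : Rt) : rt a = rt b -> a = b.
Proof.
case: a b => [x hx] [y hy] /= E; subst y; congr exist; exact: Prop_irrelevance.
Qed.

Let rop_in f (hf : is_function2 f (fcarrier K) (fcarrier K) (fcarrier K))
  (a b : Rt) : the (maps2 f (rt a) (rt b)) ∈ fcarrier K.
Proof.
have [tot dom _] := function2P hf.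
by have [_ _] := dom _ _ _ (theP (tot _ _ (rtP a) (rtP b))).
Qed.

Let rop f hf (a b : Rt) : Rt := mkRt (@rop_in f hf a b).

Let ropE f hf a b z : maps2 f (rt a) (rt b) z <-> rt (@rop f hf a b) = z.
Proof.
have [tot _ uniq] := function2P hf.
have H := theP (tot _ _ (rtP a) (rtP b)).
by split=> [|<-] //; exact: uniq.
Qed.

Let radd := rop (rl_add hK).
Let rmul := rop (rl_mul hK).
Let r0 : Rt := mkRt (rl_zero hK).
Let r1 : Rt := mkRt (rl_one hK).

Let addE a b z : maps2 (fadd K) (rt a) (rt b) z <-> rt (radd a b) = z.
Proof. exact: ropE. Qed.

Let mulE a b z : maps2 (fmul K) (rt a) (rt b) z <-> rt (rmul a b) = z.
Proof. exact: ropE. Qed.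

Let raddC : commutative radd.
Proof.
move=> a b; apply/rt_inj/esym/addE/(rl_addC hK) => //; exact/addE.
Qed.

Let raddA : associative radd.
Proof.
move=> a b c; apply/rt_inj/addE.
apply: (rl_addA hK (x := rt a) (y := rt b) (z := rt c)
  (u := rt (radd a b))) => //; exact/addE.
Qed.

Let radd0 : left_id r0 radd.
Proof.
move=> a; rewrite raddC; apply/rt_inj/addE; exact: (rl_add0 hK).
Qed.

Let raddN_ex a : exists b, radd a b = r0.
Proof.
have [y [yK H]] := rl_addN hK _ (rtP a); exists (mkRt yK).
by apply/rt_inj/addE.
Qed.

Let ropp a := projT1 (cid (raddN_ex a)).

Let raddN : left_inverse r0 ropp radd.
Proof. by move=> a; rewrite raddC /ropp; case: cid. Qed.

Let rmulC : commutative rmul.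
Proof.
move=> a b; apply/rt_inj/esym/mulE/(rl_mulC hK) => //; exact/mulE.
Qed.

Let rmulA : associative rmul.
Proof.
move=> a b c; apply/rt_inj/mulE.
apply: (rl_mulA hK (x := rt a) (y := rt b) (z := rt c)
  (u := rt (rmul a b))) => //; exact/mulE.
Qed.

Let rmul1 : left_id r1 rmul.
Proof.
move=> a; rewrite rmulC; apply/rt_inj/mulE; exact: (rl_mul1 hK).
Qed.

Let rmulD : left_distributive rmul radd.
Proof.
move=> a b c; rewrite ![rmul _ c]rmulC; apply/rt_inj/mulE.
apply: (rl_mulD hK (x := rt c) (y := rt a) (z := rt b)
  (u := rt (rmul c a)) (v := rt (rmul c b))) => //; first [exact/mulE | exact/addE].
Qed.

Let r1_neq0 : r1 != r0.
Proof. by apply/eqP => /(congr1 rt) /= /esym /(rl_zero_neq_one hK). Qed.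

HB.instance Definition _ := GRing.isZmodule.Build Rt raddA raddC radd0 raddN.
HB.instance Definition _ :=
  GRing.Zmodule_isComNzRing.Build Rt rmulA rmulC rmul1 rmulD r1_neq0.

Let rmulV_ex (a : Rt) : exists b : Rt, if a == 0 then b == 0 else b * a == 1.
Proof.
case: eqP => [_|/eqP a0]; first by exists 0.
have [|y [yK H]] := rl_mulV hK (x := rt a) (rtP a).
  by move=> E; move/eqP: a0; apply; apply: rt_inj.
exists (mkRt yK); rewrite mulrC; apply/eqP/rt_inj.
exact/mulE.
Qed.

Let rinv a := projT1 (cid (rmulV_ex a)).

Let rmulV (a : Rt) : a != 0 -> rinv a * a = 1.
Proof. by rewrite /rinv; case: cid => b /=; case: ifP => // _ /eqP. Qed.

Let rinv0 : rinv 0 = 0.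
Proof. by rewrite /rinv; case: cid => b /=; rewrite eqxx => /eqP. Qed.

HB.instance Definition _ := GRing.ComNzRing_isField.Build Rt rmulV rinv0.

Let rle' (a b : Rt) : bool := `[< rle K (rt a) (rt b) >].
Let rlt' (a b : Rt) : bool := (b != a) && rle' a b.
Let rnorm (a : Rt) : Rt := if rle' 0 a then a else - a.

Let rle_add (a b c : Rt) : rle' a b -> rle' (a + c) (b + c).
Proof.
move=> /asboolP H; apply/asboolP.
apply: (rl_le_add hK (x := rt a) (y := rt b) (z := rt c)) => //; exact/addE.
Qed.

Let rle0_add (a b : Rt) : rle' 0 a -> rle' 0 b -> rle' 0 (a + b).
Proof.
move=> /asboolP a0 /[dup] b0 /(@rle_add _ _ a) /asboolP; rewrite add0r addrC => H.
by apply/asboolP; apply: (rl_le_trans hK (y := rt a)).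
Qed.

Let rle0_mul (a b : Rt) : rle' 0 a -> rle' 0 b -> rle' 0 (a * b).
Proof.
move=> /asboolP a0 /asboolP b0; apply/asboolP.
by apply: (rl_le_mul hK (x := rt a) (y := rt b)) => //; exact/mulE.
Qed.

Let rle0_anti (a : Rt) : rle' 0 a -> rle' a 0 -> a = 0.
Proof.
by move=> /asboolP a0 /asboolP a0'; apply/rt_inj/(rl_le_anti hK).
Qed.

Let rsub_ge0 (a b : Rt) : rle' 0 (b - a) = rle' a b.
Proof.
apply/idP/idP => [/(@rle_add _ _ a)|/(@rle_add _ _ (- a))].
  by rewrite add0r subrK.
by rewrite subrr.
Qed.

Let rle0_total (a : Rt) : rle' 0 a || rle' a 0.
Proof.
have [H|H] := rl_le_total hK _ _ (rtP 0) (rtP a); apply/orP; [left|right]; exact/asboolP.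
Qed.

Let rnormN (a : Rt) : rnorm (- a) = rnorm a.
Proof.
have N : rle' 0 (- a) = rle' a 0 by rewrite -[- a]add0r rsub_ge0.
rewrite /rnorm N opprK; have := rle0_total a.
case: ifP => H; case: ifP => H' //= _.
by rewrite (rle0_anti H' H) oppr0.
Qed.

Let rnorm_ge0 (a : Rt) : rle' 0 a -> rnorm a = a.
Proof. by rewrite /rnorm => ->. Qed.

Let rlt_def (a b : Rt) : rlt' a b = (b != a) && rle' a b.
Proof. by []. Qed.

HB.instance Definition _ := Num.IntegralDomain_isLeReal.Build Rt
  rle0_add rle0_mul rle0_anti rsub_ge0 rle0_total rnormN rnorm_ge0 rlt_def.

Lemma real_presentation : presentation.
Proof.
apply: (@Presentation (Rt : realFieldType) rt) => //.
- by move=> x xK; exists (mkRt xK).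
- by move=> a b; exact: (rwP (asboolP (rle K (rt a) (rt b)))).
Qed.

End Field.

Variable R : presentation.
Local Notation F := (rF R).
Local Notation v := (@rv R).
Local Open Scope ring_scope.

(** The inverse of [v], with value 0 outside of the real line. *)
Definition wr (x : M) : F :=
  if pselect (x ∈ fcarrier K) is left h then projT1 (cid (rv_surj R h)) else 0.

Lemma wr_in x : x ∈ fcarrier K -> v (wr x) = x.
Proof. by rewrite /wr; case: pselect => // h _; case: cid. Qed.

Lemma wr_out x : ~ x ∈ fcarrier K -> wr x = 0.
Proof. by rewrite /wr; case: pselect. Qed.

Lemma wrK : cancel v wr.
Proof. by move=> a; apply/rv_inj/wr_in/rv_in. Qed.

Lemma rltE a b : rlt K (v a) (v b) <-> a < b.
Proof.
rewrite /rlt rv_le lt_neqAle; split=> [[-> ne]|/andP[/eqP ne ->]].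
  by rewrite andbT; apply/eqP => E; apply: ne; rewrite E.
by split=> // /rv_inj.
Qed.

Lemma dfn_allF (Q : F -> (nat -> M) -> Prop) :
  dfn (fun e => Q (wr (e 0%N)) (fun n => e n.+1)) -> dfn (fun e => forall r, Q r e).
Proof.
move=> dQ; apply: (dfn_ext _ (@dfn_all _ (fun x e => Q (wr x) e) dQ)) => e.
by split=> H r; [have := H (v r); rewrite wrK | exact: H].
Qed.

Lemma dfn_exF (Q : F -> (nat -> M) -> Prop) :
  dfn (fun e => Q (wr (e 0%N)) (fun n => e n.+1)) -> dfn (fun e => exists r, Q r e).
Proof.
move=> dQ; apply: (dfn_ext _ (@dfn_ex _ (fun x e => Q (wr x) e) dQ)) => e.
by split=> -[r H]; [exists (wr r) | exists (v r); rewrite wrK].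
Qed.

Lemma dterm_wr (t : (nat -> M) -> M) : dterm t -> dterm (fun e => v (wr (t e))).
Proof.
apply: (@dterm_op1 _ (fun x => v (wr x))).
apply: (@dfn_ext _ (fun e => (e 1%N ∈ fcarrier K /\ e 1%N = e 0%N) \/
  (~ e 1%N ∈ fcarrier K /\ fzero K = e 0%N))); last by dfn.
move=> e; have [H|H] := pselect (e 1%N ∈ fcarrier K).
  by rewrite wr_in //; tauto.
by rewrite wr_out // rv_0; tauto.
Qed.

(** An operation of [F] whose graph is a set of the model is definable. *)
Lemma dterm_maps2 (f : M) (h : F -> F -> F) (a b : (nat -> M) -> F) :
  (forall x y z, maps2 f (v x) (v y) z <-> v (h x y) = z) ->
  dterm (fun e => v (a e)) -> dterm (fun e => v (b e)) ->
  dterm (fun e => v (h (a e) (b e))).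
Proof.
move=> fE da db.
have -> : (fun e => v (h (a e) (b e))) =
    (fun e => v (h (wr (v (a e))) (wr (v (b e))))).
  by apply: funext => e; rewrite !wrK.
apply: (@dterm_op2 _ (fun x y => v (h (wr x) (wr y)))) => //.
apply: (@dfn_ext _ (fun e => pr (pr (v (wr (e 1%N))) (v (wr (e 2%N)))) (e 0%N) ∈ f)).
  by move=> e; rewrite -maps2E.
by apply: (dfn_mem w); last exact: dterm_const; apply: dterm_pr;
  first apply: dterm_pr; last exact: (dterm_var w); apply: dterm_wr;
  exact: (dterm_var w).
Qed.

Lemma dterm_add (a b : (nat -> M) -> F) :
  dterm (fun e => v (a e)) -> dterm (fun e => v (b e)) ->
  dterm (fun e => v (a e + b e)).
Proof. apply: dterm_maps2; exact: rv_add. Qed.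

Lemma dterm_mul (a b : (nat -> M) -> F) :
  dterm (fun e => v (a e)) -> dterm (fun e => v (b e)) ->
  dterm (fun e => v (a e * b e)).
Proof. apply: dterm_maps2; exact: rv_mul. Qed.

Lemma dfn_related f (t s : (nat -> M) -> M) : dterm t -> dterm s ->
  dfn (fun e => related f (t e) (s e)).
Proof.
move=> dt ds; apply: (@dfn_ext _ (fun e => pr (t e) (s e) ∈ f)).
  by move=> e; rewrite relatedE.
by dfn.
Qed.

Lemma dfn_le (a b : (nat -> M) -> F) :
  dterm (fun e => v (a e)) -> dterm (fun e => v (b e)) ->
  dfn (fun e => (a e <= b e)%R).
Proof.
move=> da db; apply: (dfn_ext _ (dfn_related (fle K) da db)) => e.
exact: rv_le.
Qed.

Lemma dfn_lt (a b : (nat -> M) -> F) :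
  dterm (fun e => v (a e)) -> dterm (fun e => v (b e)) ->
  dfn (fun e => (a e < b e)%R).
Proof.
move=> da db; apply: (dfn_ext _ (dfn_not w (dfn_le db da))) => e.
by rewrite ltNge; split=> /negP.
Qed.

Lemma dfn_eqF (a b : (nat -> M) -> F) :
  dterm (fun e => v (a e)) -> dterm (fun e => v (b e)) ->
  dfn (fun e => a e = b e).
Proof.
move=> da db; apply: (dfn_ext _ (dfn_eq w da db)) => e.
by split=> [/rv_inj|->].
Qed.

Ltac dterm_user ::=
  first [apply dterm_wr | apply dterm_add | apply dterm_mul
        | apply dterm_suc | apply dterm_pr].
Ltac dfn_user ::=
  first [apply dfn_related | apply dfn_le | apply dfn_lt | apply dfn_eqF
        | apply dfn_allF | apply dfn_exF].

(** Completeness of the real line, for the definable subsets of [F]. *)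
Lemma lub_ex (Q : F -> Prop) : dfn (fun e => Q (wr (e 0%N))) ->
  (exists a, Q a) -> (exists b, forall a, Q a -> a <= b) ->
  exists m, (forall a, Q a -> a <= m) /\
            (forall b, (forall a, Q a -> a <= b) -> m <= b).
Proof.
move=> dQ [a Qa] [b Hb].
have SE := sepE (fcarrier K) (Q := fun x => Q (wr x)) dQ.
have Sv r : v r ∈ sep (fcarrier K) (fun x => Q (wr x)) <-> Q r.
  by rewrite SE wrK; split=> [[]|] //; split=> //; exact: rv_in.
have [|||s [sK [ub lub]]] := rl_complete hK (S := sep (fcarrier K) (fun x => Q (wr x))).
- by move=> x /SE[].
- by exists (v a); apply/Sv.
- exists (v b); split; first exact: rv_in.
  by move=> x /[dup] /SE[/wr_in <- _] /Sv Qx; apply/rv_le/Hb.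
- have [m E] := rv_surj R sK; subst s; exists m; split.
    by move=> r /Sv /ub /rv_le.
  move=> c Hc; apply/rv_le/lub; first exact: rv_in.
  by move=> x /[dup] /SE[/wr_in <- _] /Sv Qx; apply/rv_le/Hc.
Qed.

Lemma glb_ex (Q : F -> Prop) : dfn (fun e => Q (wr (e 0%N))) ->
  (exists a, Q a) -> (exists b, forall a, Q a -> b <= a) ->
  exists m, (forall a, Q a -> m <= a) /\
            (forall b, (forall a, Q a -> b <= a) -> b <= m).
Proof.
move=> dQ [a Qa] bQ.
have [||m [ub lub]] := @lub_ex (fun b => forall a, Q a -> b <= a) _ bQ.
- dfn; exact: (dfn_ren (fun n => 0%N) dQ).
- by exists a => b; exact.
exists m; split=> // c Qc; apply: lub => b; exact.
Qed.

(** * Metrics with values in the ordered field *)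

(** The value of the metric [d] of the model in [F]; junk unless d(x, y) is
defined. *)
Definition dist (d x y : M) : F := wr (the (maps2 d x y)).

(** The axioms of a metric on [X] for a function [D] with values in [F]. *)
Record metric_on (X : M) (D : M -> M -> F) : Prop := {
  mo_ge0 : forall x y, x ∈ X -> y ∈ X -> 0 <= D x y;
  mo_eq0 : forall x y, x ∈ X -> y ∈ X -> D x y = 0 <-> x = y;
  mo_sym : forall x y, x ∈ X -> y ∈ X -> D x y = D y x;
  mo_tri : forall x y z, x ∈ X -> y ∈ X -> z ∈ X -> D x z <= D x y + D y z
}.

Section Dist.
Variables (X d : M) (hd : is_function2 d X X (fcarrier K)).

Lemma distE x y z : maps2 d x y z <-> [/\ x ∈ X, y ∈ X & v (dist d x y) = z].
Proof.
have [tot dom uniq] := function2P hd; rewrite /dist; split=> [H|[xX yX <-]].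
  have H' := theP (ex_intro _ _ H); have [xX yX tK] := dom _ _ _ H'.
  by rewrite wr_in //; split=> //; exact: uniq H' H.
have H := theP (tot _ _ xX yX); rewrite wr_in //.
by have [] := dom _ _ _ H.
Qed.

Lemma dterm_dist t s : dterm t -> dterm s -> dterm (fun e => v (dist d (t e) (s e))).
Proof.
move=> dt ds; apply: dterm_wr; move: dt ds.
apply: (@dterm_op2 _ (fun x y => the (maps2 d x y))).
apply: (@dfn_ext _ (fun e => pr (pr (e 1%N) (e 2%N)) (e 0%N) ∈ d \/
  ~ (exists z, pr (pr (e 1%N) (e 2%N)) z ∈ d) /\ w = e 0%N)); last by dfn.
move=> e; have [_ _ uniq] := function2P hd.
have [ex|nex] := pselect (exists z, maps2 d (e 1%N) (e 2%N) z).
  have H := theP ex; split=> [[/maps2E|[nex _]]|<-].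
  - exact: uniq.
  - by case: nex; case: ex => z /maps2E; exists z.
  - by left; apply/maps2E.
have -> : the (maps2 d (e 1%N) (e 2%N)) = w by rewrite /the; case: pselect.
split=> [[H|[]]|<-] //; first by case: nex; exists (e 0%N); apply/maps2E.
by right; split=> // -[z /maps2E H]; case: nex; exists z.
Qed.

Lemma metric_on_dist : is_metric K X d -> metric_on X (dist d).
Proof.
move=> m; have H x y : x ∈ X -> y ∈ X -> maps2 d x y (v (dist d x y)).
  by move=> xX yX; apply/distE.
split.
- by move=> x y xX yX; apply/rv_le; rewrite rv_0; exact: (met_nonneg m xX yX (H _ _ xX yX)).
- move=> x y xX yX; rewrite -(met_zero m _ _ xX yX); split=> [E|].
    by rewrite -(rv_0 R) -E; exact: H.
  by move=> /distE[_ _]; rewrite -(rv_0 R) => /rv_inj.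
- move=> x y xX yX; apply: rv_inj.
  by have /distE[_ _ ->] := met_sym m yX xX (H _ _ yX xX).
- move=> x y z xX yX zX; apply/rv_le.
  by apply: (met_triangle m xX yX zX (H _ _ xX yX) (H _ _ yX zX) (H _ _ xX zX));
     apply/rv_add.
Qed.

Lemma is_metric_dist : metric_on X (dist d) -> is_metric K X d.
Proof.
move=> m; split=> //.
- move=> x y r xX yX /distE[_ _ <-]; rewrite -(rv_0 R); apply/rv_le.
  exact: mo_ge0 m _ _ xX yX.
- move=> x y xX yX; rewrite -(mo_eq0 m xX yX) distE -(rv_0 R).
  by split=> [[_ _ /rv_inj]|->].
- move=> x y r xX yX /distE[_ _ <-]; apply/distE; split=> //.
  by rewrite (mo_sym m xX yX).
- move=> x y z r s t u xX yX zX /distE[_ _ <-] /distE[_ _ <-] /distE[_ _ <-].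
  by move=> /rv_add <-; apply/rv_le/(mo_tri m).
Qed.

Lemma metric_topologyE T : is_metric_topology K X d T <-> forall U, U ∈ T <->
  subset U X /\ forall x, x ∈ U -> exists r, 0 < r /\
    forall y, y ∈ X -> dist d x y < r -> y ∈ U.
Proof.
suff H U : subset U X ->
  (forall x, x ∈ U -> exists r, r ∈ fcarrier K /\ rlt K (fzero K) r /\
      forall y s, y ∈ X -> maps2 d x y s -> rlt K s r -> y ∈ U) <->
  (forall x, x ∈ U -> exists r, 0 < r /\
    forall y, y ∈ X -> dist d x y < r -> y ∈ U).
  by split=> G U; rewrite G; split=> -[UX]; (split; first exact: UX); apply/H.
move=> UX; split=> G x xU; have := G x xU.
  move=> [r [/(rv_surj R) [a <-] []]].
  rewrite -(rv_0 R) rltE => a0 Ha; exists a; split=> // y yX Dxy.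
  apply: (Ha y (v (dist d x y)) yX); last exact/rltE.
  by apply/distE; split=> //; exact: UX.
move=> [a [a0 Ha]]; exists (v a); split; first exact: rv_in.
split; first by rewrite -(rv_0 R) rltE.
by move=> y s yX /distE[_ _ <-] /rltE; exact: Ha.
Qed.

Lemma diameterE A a : subset A X -> is_diameter K d A (v a) <->
  (forall x y, x ∈ A -> y ∈ A -> dist d x y <= a) /\
  (forall b, (forall x y, x ∈ A -> y ∈ A -> dist d x y <= b) -> a <= b).
Proof.
move=> AX; split=> [[_ [ub lub]]|[ub lub]].
  split=> [x y xA yA|b Hb]; first apply/rv_le/ub.
    by exists x, y; rewrite distE; split=> //; split=> //; split=> //; exact: AX.
  apply/rv_le/lub; first exact: rv_in.
  by move=> s [x [y [xA [yA /distE[_ _ <-]]]]]; apply/rv_le/Hb.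
split; first exact: rv_in; split.
  by move=> s [x [y [xA [yA /distE[_ _ <-]]]]]; apply/rv_le/ub.
move=> s /(rv_surj R)[b <-] Hb; apply/rv_le/lub => x y xA yA; apply/rv_le/Hb.
by exists x, y; rewrite distE; split=> //; split=> //; split=> //; exact: AX.
Qed.

(** A metric topology is a topology. *)
Lemma metric_topology_topology T : is_metric_topology K X d T -> is_topology X T.
Proof.
move=> /metric_topologyE TE; split.
- by move=> U /TE[].
- by move=> U U0; apply/TE; split=> x /U0.
- by apply/TE; split=> // x _; exists 1; split.
- move=> A U AT UE; apply/TE; split.
    by move=> x /UE[V [/AT /TE[VX _]]] /VX.
  move=> x /UE[V [VA xV]]; have /TE[_ /(_ x xV)[r [r0 Hr]]] := AT _ VA.
  by exists r; split=> // y yX Dxy; apply/UE; exists V; split=> //; exact: Hr.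
- move=> U V G /TE[UX HU] /TE[VX HV] GE; apply/TE; split.
    by move=> x /GE[/UX].
  move=> x /GE[/HU[r [r0 Hr]] /HV[s [s0 Hs]]].
  exists (Order.min r s); rewrite lt_min r0 s0; split=> // y yX.
  by rewrite lt_min => /andP[H1 H2]; apply/GE; split; [exact: Hr|exact: Hs].
Qed.

End Dist.

(** * Dyadic weights *)

(** [S] contains (0, 1), and (n + 1, r / 2) whenever it contains (n, r). *)
Definition wclosed (S : M) := (forall z : M, is_empty z -> pr z (v 1) ∈ S) /\
  (forall n r, pr n (v r) ∈ S -> pr (suc n) (v (r / 2)) ∈ S).

(** [wt n r] means r = 2^-n: the pair (n, r) is in the least set closed in the
above sense. *)
Definition wt (n : M) (r : F) := forall S, wclosed S -> pr n (v r) ∈ S.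

Ltac dfn_unfold :=
  match goal with
  | |- dfn (fun e => wclosed (@?a e)) => unfold wclosed
  | |- dfn (fun e => wt (@?a e) (@?b e)) => unfold wt
  end.
Ltac dfn_user ::=
  first [dfn_unfold | apply dfn_related | apply dfn_le | apply dfn_lt | apply dfn_eqF
        | apply dfn_allF | apply dfn_exF].

Lemma omega_suc n : n ∈ w -> suc n ∈ w.
Proof. by move=> /(proj2 (proj1 hw))[y [yw /is_succE ->]]. Qed.

Lemma empty_unique (x y : M) : is_empty x -> is_empty y -> x = y.
Proof. by move=> x0 y0; apply: ext => z; split=> [/x0|/y0]. Qed.

Lemma omega_empty (z : M) : is_empty z -> z ∈ w.
Proof.
move=> z0; have [[y [yw y0]] _] := proj1 hw.
by rewrite (empty_unique z0 y0).
Qed.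

Lemma wt_empty (z : M) : is_empty z -> wt z 1.
Proof. by move=> z0 S hS; exact: (proj1 hS). Qed.

Lemma wt_suc n r : wt n r -> wt (suc n) (r / 2).
Proof. by move=> nr S hS; exact: (proj2 hS) _ _ (nr S hS). Qed.

(** Induction along the weights, for definable properties. *)
Lemma wt_ind (Q : M -> F -> Prop) : dfn (fun e => Q (e 0%N) (wr (e 1%N))) ->
  (forall z : M, is_empty z -> Q z 1) ->
  (forall n r, wt n r -> Q n r -> Q (suc n) (r / 2)) ->
  forall n r, wt n r -> Q n r.
Proof.
move=> dQ Q0 Q1 n r nr.
have dQ' : dfn (fun e => Q (e 1%N) (wr (e 0%N))).
  exact: (dfn_ren (fun n => match n with 0 => 1 | 1 => 0 | _ => 0 end)%N dQ).
pose S := sep (prod w (fcarrier K))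
  (fun p => exists n r, p = pr n (v r) /\ wt n r /\ Q n r).
have SE k q : pr k (v q) ∈ S <-> k ∈ w /\ wt k q /\ Q k q.
  rewrite sepE.
    rewrite pr_prod; split=> [[[kw _] [k' [q' [/pr_inj[<- /rv_inj <-]]]]]|[kw [kq Qkq]]] //.
    split; first by split=> //; exact: rv_in.
    by exists k, q.
  dfn; exact: (dfn_ren (fun n => match n with 0 => 0 | 1 => 1 | _ => 0 end)%N dQ').
have /SE[_ []//] : pr n (v r) ∈ S.
apply: nr; split=> [z z0|k q /SE[kw [kq Qkq]]]; apply/SE.
  by split; [exact: omega_empty | split; [exact: wt_empty | exact: Q0]].
by split; [exact: omega_suc | split; [exact: wt_suc | exact: Q1]].
Qed.

Lemma wt_total n : n ∈ w -> exists r, wt n r.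
Proof.
pose S := sep w (fun n => exists r, wt n r).
have SE k : k ∈ S <-> k ∈ w /\ exists r, wt k r by rewrite sepE //; dfn.
have ind : is_inductive S.
  split.
    have [[z [zw z0]] _] := proj1 hw; exists z; split=> //.
    by apply/SE; split=> //; exists 1; exact: wt_empty.
  move=> k /SE[kw [r kr]]; exists (suc k); split; last exact/is_succE.
  by apply/SE; split; [exact: omega_suc | exists (r / 2); exact: wt_suc].
by move=> /(proj2 hw _ ind) /SE[].
Qed.

Lemma wt_bounds n r : wt n r -> 0 < r /\ r <= 1.
Proof.
move: n r; apply: wt_ind; first by dfn.
  by move=> _ _; rewrite ltr01 lexx.
by move=> _ r _ [r0 r1]; split; lra.
Qed.

Lemma wt_inv n r : wt n r ->
  (is_empty n /\ r = 1) \/ exists k q, wt k q /\ n = suc k /\ r = q / 2.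
Proof.
move: n r; apply: wt_ind; first by dfn.
  by move=> z z0; left.
by move=> n r nr _; right; exists n, r.
Qed.

(** If r is the weight of n, a weight in the interval ]r/2, r] belongs to n. *)
Lemma wt_gap n r : wt n r ->
  forall k q, wt k q -> r / 2 < q -> q <= r -> k = n.
Proof.
move: n r; apply: wt_ind; first by dfn.
  move=> z z0 k q /wt_inv[[k0 _]|[k' [q' [/wt_bounds[_ q1] [_ ->]]]]].
    by move=> _ _; exact: empty_unique.
  by move=> H; exfalso; lra.
move=> n r /wt_bounds[_ r1] IH k q /wt_inv[[_ ->]|[k' [q' [kq [-> ->]]]]] H1 H2.
  by exfalso; lra.
by rewrite (IH k' q' kq) //; lra.
Qed.

(** The weights tend to 0: their infimum m satisfies 2 m <= m. *)
Lemma wt_small e : 0 < e -> exists n r, wt n r /\ r <= e.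
Proof.
move=> e0; have [||| m [lb glb]] := @glb_ex (fun r => exists n, wt n r).
- by dfn.
- have [[z [_ z0]] _] := proj1 hw; exists 1, z; exact: wt_empty.
- by exists 0 => r [n /wt_bounds[/ltW]].
have m0 : m <= 0.
  suff : m * 2 <= m by lra.
  apply: glb => r [n nr]; have := lb (r / 2) (ex_intro _ (suc n) (wt_suc nr)); lra.
apply: contrapT => H; suff : e <= m by lra.
apply: glb => r [n nr]; rewrite leNgt; apply/negP => re.
by apply: H; exists n, r; split=> //; exact: ltW.
Qed.

(** * Closeness in a countable intersection of open sets *)

Section Gdelta.
Variables (X T d Y U : M).
Hypothesis TX : is_metric_topology K X d T.
Hypothesis dX : is_Cantor_complete w K X d.
Hypothesis Ufun : is_function U w T.
Hypothesis YU : forall x, x ∈ Y <-> forall n A, n ∈ w -> related U n A -> x ∈ A.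

Let hm : is_metric K X d := proj1 dX.
Let hd : is_function2 d X X (fcarrier K) := met_fun hm.
Let mo : metric_on X (dist d) := metric_on_dist hd hm.
Local Notation D := (dist d).

Let TE : forall O, O ∈ T <-> subset O X /\ forall x, x ∈ O ->
  exists r, 0 < r /\ forall y, y ∈ X -> D x y < r -> y ∈ O.
Proof. exact/(metric_topologyE hd). Qed.

Let related_U n A : related U n A -> n ∈ w /\ A ∈ T.
Proof.
move=> nA; split; last exact: (proj2 Ufun _ _ nA).
move: nA => /relatedE /(proj1 (proj1 Ufun))[a [b [aw /is_pairE /pr_inj[<- _]]]] //.
Qed.

Let U_fun n A A' : related U n A -> related U n A' -> A = A'.
Proof.
move=> nA nA'; have [nw _] := related_U nA.
have [B [_ uniq]] := proj2 (proj1 Ufun) _ nw.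
by rewrite -(uniq _ nA) (uniq _ nA').
Qed.

Let YX x : x ∈ Y -> x ∈ X.
Proof.
move=> /YU H; have [[z [zw _]] _] := proj1 hw.
have [A [zA _]] := proj2 (proj1 Ufun) _ zw.
have [_ /TE[AX _]] := related_U zA.
exact/AX/(H z).
Qed.

(** The open ball of radius 1/s around x is contained in A; for s = 0, the whole
of X is. *)
Definition ball_in (A x : M) (s : F) :=
  forall y, y ∈ X -> s * D x y < 1 -> y ∈ A.

(** For f_A(x) the infimum, possibly infinite, of the s >= 0 with [ball_in A x s],
which is the inverse of the distance from x to the complement of A:
f_A(x) <= f_A(y) + t. *)
Definition ctrl (A x y : M) (t : F) :=
  forall s, 0 <= s -> ball_in A y s -> ball_in A x (s + t).

(** A is the n-th open set, for some n with r = 2^-n. *)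
Definition weight (A : M) (r : F) := exists n, wt n r /\ related U n A.

(** The relation rho(x, y) <= t, where rho(x, y) is the supremum of d(x, y) and
of the min (2^-n, |f_A(x) - f_A(y)|), for A the n-th open set. *)
Definition near (x y : M) (t : F) := 0 <= t /\ D x y <= t /\
  forall A r, weight A r -> t < r -> ctrl A x y t /\ ctrl A y x t.

Ltac dfn_unfold ::=
  match goal with
  | |- dfn (fun e => wclosed (@?a e)) => unfold wclosed
  | |- dfn (fun e => wt (@?a e) (@?b e)) => unfold wt
  | |- dfn (fun e => weight (@?a e) (@?b e)) => unfold weight
  | |- dfn (fun e => near (@?a e) (@?b e) (@?c e)) => unfold near
  | |- dfn (fun e => ctrl (@?a e) (@?b e) (@?c e) (@?f e)) => unfold ctrl
  | |- dfn (fun e => ball_in (@?a e) (@?b e) (@?c e)) => unfold ball_in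
  end.
Ltac dterm_user ::=
  first [apply (dterm_dist hd) | apply dterm_wr | apply dterm_add
        | apply dterm_mul | apply dterm_suc | apply dterm_pr].

Lemma ball_in_mono A x s s' : x ∈ X -> s <= s' -> ball_in A x s -> ball_in A x s'.
Proof.
move=> xX ss' H y yX Hy; apply: H => //; apply: le_lt_trans Hy.
by apply: ler_wpM2r => //; exact: (mo_ge0 mo xX yX).
Qed.

Lemma ball_in_open A x : A ∈ T -> x ∈ A -> exists s, 0 < s /\ ball_in A x s.
Proof.
move=> /TE[AX AO] xA; have [r [r0 Hr]] := AO _ xA.
exists r^-1; rewrite invr_gt0; split=> // y yX; rewrite mulrC ltr_pdivrMr // mul1r.
exact: Hr.
Qed.

(** If f_A(p) <= s <= s0 and q is close to p, how close depending on s0 and t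
only, then f_A(q) <= s + t. *)
Lemma ball_in_near A p q s s0 t : p ∈ X -> q ∈ X -> 0 < t -> 0 <= s -> s <= s0 ->
  s0 * (s0 + t) * D p q <= t -> ball_in A p s -> ball_in A q (s + t).
Proof.
move=> pX qX t0 s_ge0 ss0 H Hp z zX Hz; apply: Hp => //.
have := mo_tri mo pX qX zX; have := mo_ge0 mo pX qX.
move: (D p q) (D q z) (D p z) H Hz => a b c Ha Hb a0 cab.
have [->|/eqP s_neq0] := pselect (s = 0); first by rewrite mul0r ltr01.
have s_gt0 : 0 < s by rewrite lt_def s_neq0.
have H1 : s * (s + t) * a <= t.
  apply: le_trans Ha; apply: ler_wpM2r => //; nra.
have H2 : s * ((s + t) * b) < s * 1 by rewrite ltr_pM2l.
have H3 : s * (s + t) * c <= s * (s + t) * (a + b).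
  by apply: ler_wpM2l => //; nra.
rewrite -(ltr_pM2l (_ : 0 < s + t)); lra.
Qed.

(** Continuity of f_A at the points of A. *)
Lemma ctrl_continuous A x t : A ∈ T -> x ∈ A -> 0 < t ->
  exists e, 0 < e /\ forall y, y ∈ X -> D x y < e -> ctrl A x y t /\ ctrl A y x t.
Proof.
move=> AT xA t0; have [s0 [s0_gt0 Hs0]] := ball_in_open AT xA.
have xX : x ∈ X by have /TE[AX _] := AT; exact: AX.
have c0 : 0 < s0 * (s0 + t) by rewrite mulr_gt0 // addr_gt0.
exists (t / (s0 * (s0 + t))); split; first exact: divr_gt0.
move=> y yX; rewrite ltr_pdivlMr // mulrC => /ltW Hxy; split=> s s_ge0 Hs.
  have [ss0|s0s] := leP s s0; last first.
    by apply: (ball_in_mono xX _ Hs0); lra.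
  by apply: (@ball_in_near A y x s s0 t) => //; rewrite (mo_sym mo).
have [ss0|s0s] := leP s s0.
  exact: (@ball_in_near A x y s s0 t).
apply: (@ball_in_mono A y (s0 + t)) => //; first by lra.
apply: (@ball_in_near A x y s0 s0 t) => //; exact: ltW.
Qed.

(** Continuity at x, uniformly in the finitely many open sets of weight greater
than r. In the induction on r, only one open set is added at each step, by
[wt_gap]. *)
Lemma weight_near x t n r : x ∈ Y -> 0 < t -> wt n r ->
  exists e, 0 < e /\ forall A q, weight A q -> r < q ->
    forall y, y ∈ X -> D x y < e -> ctrl A x y t /\ ctrl A y x t.
Proof.
move=> xY t0; move: n r; apply: wt_ind; first by dfn.
  move=> z z0; exists 1; split=> // A q [n [/wt_bounds[_ q1] _]] q1'.
  by exfalso; lra.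
move=> n r nr [e [e0 He]].
have [[A nA]|noA] := pselect (exists A, related U n A).
  have [nw AT] := related_U nA; have xA : x ∈ A by exact: (proj1 (YU x) xY n).
  have [e' [e'0 He']] := ctrl_continuous AT xA t0.
  exists (Order.min e e'); rewrite lt_min e0 e'0; split=> // B q Bq rq y yX.
  rewrite lt_min => /andP[De De'].
  have [rq'|qr] := ltP r q; first exact: He Bq rq' y yX De.
  have [k [kq kB]] := Bq; move: kB; rewrite (wt_gap nr kq rq qr) => /(U_fun nA) <-.
  exact: He'.
exists e; split=> // B q Bq rq y yX De.
have [rq'|qr] := ltP r q; first exact: He Bq rq' y yX De.
have [k [kq kB]] := Bq; case: noA; exists B.
by rewrite -(wt_gap nr kq rq qr).
Qed.

Lemma near_continuous x t : x ∈ Y -> 0 < t ->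
  exists e, 0 < e /\ forall y, y ∈ X -> D x y < e -> near x y t.
Proof.
move=> xY t0; have [n [r [nr rt]]] := wt_small t0.
have [e [e0 He]] := weight_near xY t0 nr.
exists (Order.min e t); rewrite lt_min e0 t0; split=> // y yX.
rewrite lt_min => /andP[De Dt]; split; first exact: ltW.
split; first exact: ltW.
by move=> A q Aq tq; apply: (He A q Aq _ y yX De); exact: le_lt_trans tq.
Qed.

Lemma near_refl x : x ∈ X -> near x x 0.
Proof.
move=> xX; split=> //; split; first by rewrite (proj2 (mo_eq0 mo xX xX) erefl).
by move=> A r _ _; split=> s _; rewrite addr0.
Qed.

Lemma near_sym x y t : x ∈ X -> y ∈ X -> near x y t -> near y x t.
Proof.
move=> xX yX [t0 [Dt H]]; split=> //; split; first by rewrite (mo_sym mo).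
by move=> A r Ar tr; have [] := H A r Ar tr.
Qed.

Lemma near_trans x y z s t : x ∈ X -> y ∈ X -> z ∈ X ->
  near x y s -> near y z t -> near x z (s + t).
Proof.
move=> xX yX zX [s0 [Ds Hs]] [t0 [Dt Ht]]; split; first exact: addr_ge0.
split; first by apply: le_trans (mo_tri mo xX yX zX) _; exact: lerD.
move=> A r Ar str; have [|Hxy Hyx] := Hs A r Ar; first by lra.
have [|Hyz Hzy] := Ht A r Ar; first by lra.
split=> q q0 Hq.
  rewrite [s + t]addrC addrA; apply: Hxy; first exact: addr_ge0.
  exact: Hyz.
by rewrite addrA; apply: Hzy; [exact: addr_ge0 | exact: Hyx].
Qed.

Lemma ctrl_mono A x y s t : x ∈ X -> s <= t -> ctrl A x y s -> ctrl A x y t.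
Proof.
by move=> xX st H q q0 Hq; apply: ball_in_mono (H q q0 Hq) => //; rewrite lerD2l.
Qed.

Lemma near_mono x y s t : x ∈ X -> y ∈ X -> s <= t -> near x y s -> near x y t.
Proof.
move=> xX yX st [s0 [Ds H]]; split; first exact: le_trans st.
split; first exact: le_trans st.
move=> A r Ar tr; have [|H1 H2] := H A r Ar; first exact: le_lt_trans tr.
by split; [exact: ctrl_mono H1 | exact: ctrl_mono H2].
Qed.

Lemma ctrl_closed A x y t r : x ∈ X -> t < r ->
  (forall s, t < s -> s < r -> ctrl A x y s) -> ctrl A x y t.
Proof.
move=> xX tr H q q0 Hq z zX Hz.
have D0 := mo_ge0 mo xX zX; have D1 : 0 < D x z + 1 by lra.
(* a parameter e > 0 with t + e < r and (q + t + e) * D x z < 1 *)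
pose e := Order.min ((r - t) / 2) ((1 - (q + t) * D x z) / (D x z + 1)).
have e0 : 0 < e by rewrite lt_min !divr_gt0 // subr_gt0.
have e1 : e <= (r - t) / 2 by rewrite ge_min lexx.
have e2 : e * (D x z + 1) <= 1 - (q + t) * D x z.
  by rewrite -ler_pdivlMr // ge_min lexx orbT.
by apply: (H (t + e) _ _ q q0 Hq z zX); [lra | lra | nra].
Qed.

(** The set of the t with [near x y t] is closed, so that it has a minimum. *)
Lemma near_closed x y t : x ∈ X -> y ∈ X ->
  (forall s, t < s -> near x y s) -> near x y t.
Proof.
move=> xX yX H.
have lim a : (forall s, t < s -> a <= s) -> a <= t.
  move=> Ha; rewrite leNgt; apply/negP => ta.
  by have := Ha ((a + t) / 2) ltac:(lra); lra.
split; first by apply: lim => s /H[].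
split; first by apply: lim => s /H[_ []].
move=> A r Ar tr; split; apply: (ctrl_closed _ tr) => // s ts sr.
  by have [_ [_ /(_ A r Ar sr)[]]] := H s ts.
by have [_ [_ /(_ A r Ar sr)[]]] := H s ts.
Qed.

(** The weights are at most 1, so the open sets impose no condition on
[near x y t] for t >= 1. *)
Lemma near_bounded x y : x ∈ X -> y ∈ X -> near x y (D x y + 1).
Proof.
move=> xX yX; have D0 := mo_ge0 mo xX yX; split; first by lra.
split; first by lra.
by move=> A r [n [/wt_bounds[_ r1] _]] H; exfalso; lra.
Qed.

Lemma near_min x y : x ∈ X -> y ∈ X -> exists m, forall t, near x y t <-> m <= t.
Proof.
move=> xX yX; have [|||m [lb glb]] := @glb_ex (near x y).
- by dfn.
- by exists (D x y + 1); exact: near_bounded.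
- by exists 0 => t [].
exists m => t; split=> [|mt]; first exact: lb.
apply: near_mono mt _ => //; apply: near_closed => // s ms.
apply: contrapT => ns; suff : s <= m by lra.
apply: glb => a ya; rewrite leNgt; apply/negP => /ltW as_.
by apply: ns; exact: near_mono as_ ya.
Qed.

(** * The metric and the topology of the subspace *)

(** The metric of the subspace [Y]: z = rho(x, y) is the least t with
[near x y t]. *)
Definition rho : M := graph2 Y Y (fcarrier K)
  (fun x y z => z ∈ fcarrier K /\ forall t, near x y t <-> wr z <= t).

Let rho_graph x y z : maps2 rho x y z <->
  [/\ x ∈ Y, y ∈ Y, z ∈ fcarrier K & forall t, near x y t <-> wr z <= t].
Proof.
rewrite (graph2E Y Y (fcarrier K)); last by dfn.
by split=> [[[? ? ?] []]|[]].
Qed.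

Lemma rho_function : is_function2 rho Y Y (fcarrier K).
Proof.
apply: graph2_function; first by dfn.
  move=> x y /YX xX /YX yX; have [m Hm] := near_min xX yX; exists (v m).
  by split; [exact: rv_in | split; [exact: rv_in | rewrite wrK]].
move=> x y z z' [/wr_in zE Hz] [/wr_in z'E Hz']; rewrite -zE -z'E; congr v.
by apply/le_anti/andP; split; [apply/Hz/Hz' | apply/Hz'/Hz].
Qed.

Local Notation P := (dist rho).

Lemma rho_near x y t : x ∈ Y -> y ∈ Y -> P x y <= t <-> near x y t.
Proof.
move=> xY yY.
have /rho_graph[_ _ _ H] : maps2 rho x y (v (P x y)) by apply/(distE rho_function).
by rewrite H wrK.
Qed.

Lemma dist_le_rho x y : x ∈ Y -> y ∈ Y -> D x y <= P x y.
Proof. by move=> xY yY; have /(rho_near _ xY yY)[_ []] := lexx (P x y). Qed.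

Lemma rho_metric_on : metric_on Y P.
Proof.
have ge0 x y : x ∈ Y -> y ∈ Y -> 0 <= P x y.
  by move=> xY yY; have /(rho_near _ xY yY)[] := lexx (P x y).
have le_sym x y : x ∈ Y -> y ∈ Y -> P x y <= P y x.
  by move=> xY yY; apply/rho_near/near_sym/rho_near => //; exact: YX.
split=> //.
- move=> x y xY yY; split=> [E|<-].
    apply/(mo_eq0 mo (YX xY) (YX yY))/le_anti.
    by rewrite (mo_ge0 mo (YX xY) (YX yY)) andbT -E dist_le_rho.
  by apply/le_anti; rewrite ge0 // andbT; apply/rho_near/near_refl/YX.
- by move=> x y xY yY; apply/le_anti; rewrite !le_sym.
- move=> x y z xY yY zY; apply/rho_near => //.
  by apply: near_trans (YX xY) (YX yY) (YX zY) _ _; apply/rho_near.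
Qed.

Lemma rho_metric : is_metric K Y rho.
Proof. exact: is_metric_dist rho_function rho_metric_on. Qed.

Lemma rho_continuous x t : x ∈ Y -> 0 < t ->
  exists e, 0 < e /\ forall y, y ∈ Y -> D x y < e -> P x y < t.
Proof.
move=> xY t0; have [|e [e0 He]] := @near_continuous x (t / 2) xY; first by lra.
exists e; split=> // y yY De; apply: (@le_lt_trans _ _ (t / 2)); last by lra.
by apply/rho_near => //; apply: He => //; exact: YX.
Qed.

Lemma rho_topology V : is_subspace_topology T Y V -> is_metric_topology K Y rho V.
Proof.
move=> hV; apply/(metric_topologyE rho_function) => A; rewrite hV; split.
  move=> [O [/TE[OX HO] AE]]; split=> [x /AE[]|x /AE[xO xY]] //.
  have [r [r0 Hr]] := HO x xO; exists r; split=> // y yY Pr; apply/AE; split=> //.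
  by apply: Hr; [exact: YX | apply: le_lt_trans Pr; exact: dist_le_rho].
move=> [AY HA].
pose inA z r := 0 < r /\ forall y, y ∈ Y -> D z y < r -> y ∈ A.
pose O := sep X (fun z => exists r, inA z r).
have OE z : z ∈ O <-> z ∈ X /\ exists r, inA z r by rewrite sepE // /inA; dfn.
exists O; split.
  apply/TE; split=> [z /OE[]|z /OE[zX [r [r0 Hr]]]] //.
  exists (r / 2); split; first by lra.
  move=> y yX Dzy; apply/OE; split=> //; exists (r / 2); split; first by lra.
  move=> u uY Dyu; apply: Hr => //.
  have := mo_tri mo zX yX (YX uY); lra.
move=> x; split=> [xA|[/OE[xX [r [r0 Hr]]] xY]].
  have xY := AY x xA; split=> //; apply/OE; split; first exact: YX.
  have [r [r0 Hr]] := HA x xA; have [e [e0 He]] := rho_continuous xY r0.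
  by exists e; split=> // y yY De; apply: Hr => //; exact: He.
by apply: Hr => //; rewrite (proj2 (mo_eq0 mo xX xX) erefl).
Qed.

(** * Cantor completeness *)

(** The closure of A in X. *)
Definition closure (A : M) : M :=
  sep X (fun x => forall e, 0 < e -> exists y, y ∈ A /\ D x y < e).

Lemma closureE A x : x ∈ closure A <->
  x ∈ X /\ forall e, 0 < e -> exists y, y ∈ A /\ D x y < e.
Proof. by rewrite sepE //; dfn. Qed.

Lemma closure_closed A : subset A X -> is_closed X T (closure A).
Proof.
move=> AX; split; first by move=> x /closureE[].
pose O := sep X (fun x => ~ x ∈ closure A).
have OE x : x ∈ O <-> x ∈ X /\ ~ x ∈ closure A by rewrite sepE //; dfn.
exists O; split=> //; apply/TE; split=> [x /OE[]|x /OE[xX nx]] //.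
have [e [e0 He]] : exists e, 0 < e /\ forall y, y ∈ A -> e <= D x y.
  apply: contrapT => H; apply: nx; apply/closureE; split=> // e e0.
  apply: contrapT => H'; apply: H; exists e; split=> // y yA.
  by rewrite leNgt; apply/negP => De; apply: H'; exists y.
exists (e / 2); split; first by lra.
move=> z zX Dxz; apply/OE; split=> // /closureE[_ /(_ (e / 2))[|y [yA Dzy]]].
  by lra.
have := mo_tri mo xX zX (AX _ yA); have := He y yA; lra.
Qed.

Lemma closure_dist A a : subset A X ->
  (forall x y, x ∈ A -> y ∈ A -> D x y <= a) ->
  forall x y, x ∈ closure A -> y ∈ closure A -> D x y <= a.
Proof.
move=> AX Ha x y /closureE[xX Hx] /closureE[yX Hy].
rewrite leNgt; apply/negP => aD; pose e := (D x y - a) / 2.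
have e0 : 0 < e by rewrite /e; lra.
have [x' [xA' Dx]] := Hx e e0; have [y' [yA' Dy]] := Hy e e0.
have xX' := AX _ xA'; have yX' := AX _ yA'; have := Ha _ _ xA' yA'.
have := mo_tri mo xX xX' yX; have := mo_tri mo xX' yX' yX.
rewrite (mo_sym mo yX' yX); move: Dx Dy; rewrite /e; lra.
Qed.

(** The closure of a subset of [Y] has a d-diameter which is at most its
rho-diameter. *)
Lemma closure_diameter A a : subset A Y -> nonempty A -> is_diameter K rho A (v a) ->
  exists b, is_diameter K d (closure A) (v b) /\ b <= a.
Proof.
move=> AY [p pA] /(diameterE rho_function _ AY)[ub _].
have AX : subset A X by move=> x /AY/YX.
have Ha := @closure_dist A a AX _.
have {}Ha x y : x ∈ closure A -> y ∈ closure A -> D x y <= a.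
  apply: Ha => {}x {}y xA yA; apply: le_trans (ub _ _ xA yA).
  by apply: dist_le_rho; exact: AY.
have pC : p ∈ closure A.
  apply/closureE; split=> [|e e0]; first exact: AX.
  by exists p; split=> //; rewrite (proj2 (mo_eq0 mo (AX _ pA) (AX _ pA)) erefl).
have [|||b [ub' lub]] := @lub_ex (fun r => exists x y, x ∈ closure A /\ y ∈ closure A /\ r = D x y).
- by dfn.
- by exists (D p p), p, p.
- by exists a => r [x [y [xC [yC ->]]]]; exact: Ha.
exists b; split; last by apply: lub => r [x [y [xC [yC ->]]]]; exact: Ha.
apply/(diameterE hd); first by move=> x /closureE[].
split=> [x y xC yC|c Hc]; first by apply: ub'; exists x, y.
by apply: lub => r [x [y [xC [yC ->]]]]; exact: Hc.
Qed.

(** The sequence of the closures of the members of the sequence [G]. *)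
Definition closures (G : M) : M := sep (prod w (power X)) (fun p => exists n A C,
  p = pr n C /\ related G n A /\ forall x, x ∈ C <->
    x ∈ X /\ forall e, 0 < e -> exists y, y ∈ A /\ D x y < e).

Let closures_dfn G : dfn (fun e => exists n A C,
  e 0%N = pr n C /\ related G n A /\ forall x, x ∈ C <->
    x ∈ X /\ forall e, 0 < e -> exists y, y ∈ A /\ D x y < e).
Proof. by dfn. Qed.

Lemma closuresE G n C : related (closures G) n C <->
  n ∈ w /\ exists A, related G n A /\ C = closure A.
Proof.
rewrite relatedE (sepE _ (closures_dfn G)) pr_prod; split.
  move=> [[nw _] [n' [A [C' [/pr_inj[<- <-] [nA CE]]]]]]; split=> //.
  by exists A; split=> //; apply: ext => x; rewrite CE closureE.
move=> [nw [A [nA ->]]]; split.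
  by split=> //; apply/powerE => x /closureE[].
by exists n, A, (closure A); split=> //; split=> // x; exact: closureE.
Qed.

Lemma closures_function G : is_function_on G w -> is_function_on (closures G) w.
Proof.
move=> [_ Gfun]; split.
  move=> p /(sepE _ (closures_dfn G))[/prodE[n [C [nw [_ ->]]]] _].
  by exists n, C; split=> //; apply/is_pairE.
move=> n nw; have [A [nA uniq]] := Gfun n nw.
exists (closure A); split; first by apply/closuresE; split=> //; exists A.
by move=> C /closuresE[_ [A' [/uniq <- ->]]].
Qed.

Lemma rho_complete : is_Cantor_complete w K Y rho.
Proof.
split; first exact: rho_metric.
move=> T' G /(metric_topologyE rho_function) T'E Gfun Gclosed Gdesc Gdiam.
have Gw n A : related G n A -> n ∈ w.
  by move=> /relatedE /(proj1 Gfun)[a [b [aw /is_pairE /pr_inj[<- _]]]].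
have GY n A : related G n A -> subset A Y.
  by move=> nA; have [_ []] := Gclosed n A (Gw _ _ nA) nA.
have GX n A : related G n A -> subset A X by move=> nA x /(GY n A nA) /YX.
have [|||x Hx] := proj2 dX T (closures G) TX (closures_function Gfun).
- move=> n _ nw /closuresE[_ [A [nA ->]]].
  split; last by apply: closure_closed; exact: GX nA.
  have [[p pA] _] := Gclosed n A nw nA; exists p; apply/closureE.
  have pX := GX _ _ nA _ pA; split=> // e e0; exists p; split=> //.
  by rewrite (proj2 (mo_eq0 mo pX pX) erefl).
- move=> m n _ _ mw nw mn /closuresE[_ [A [mA ->]]] /closuresE[_ [B [nB ->]]].
  have BA := Gdesc _ _ _ _ mw nw mn mA nB.
  move=> z /closureE[zX Hz]; apply/closureE; split=> // e /Hz[y [yB Dy]].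
  by exists y; split=> //; exact: BA.
- move=> e eK e0; have [m [mw Hm]] := Gdiam e eK e0.
  exists m; split=> // n _ nw mn /closuresE[_ [A [nA ->]]].
  have [r [diam re]] := Hm n A nw mn nA.
  have [a Ea] := rv_surj R (proj1 diam); subst r.
  have [c Ec] := rv_surj R eK; subst e.
  have [Ane _] := Gclosed n A nw nA.
  have [b [diam' ba]] := closure_diameter (GY _ _ nA) Ane diam.
  exists (v b); split=> //; apply/rltE; apply: le_lt_trans ba _; exact/rltE.
have {}Hx n A : related G n A -> x ∈ closure A.
  move=> nA; have nw := Gw _ _ nA; apply: (Hx n) => //.
  by apply/closuresE; split=> //; exists A.
have xX : x ∈ X.
  have [[z [zw _]] _] := proj1 hw; have [A [zA _]] := proj2 Gfun _ zw.
  by have /closureE[] := Hx _ _ zA.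
have xY : x ∈ Y.
  apply/YU => n O nw nO; have [r nr] := wt_total nw; have [r0 _] := wt_bounds nr.
  have [||m [mw Hm]] := Gdiam (v r); [exact: rv_in|by rewrite -(rv_0 R) rltE|].
  have [A [mA _]] := proj2 Gfun _ mw.
  have [a' [diam]] := Hm m A mw (or_introl erefl) mA.
  have [a Ea] := rv_surj R (proj1 diam); subst a'; rewrite rltE => ar.
  have [ub _] := proj1 (diameterE rho_function a (GY _ _ mA)) diam.
  have [[p pA] _] := Gclosed m A mw mA; have pY := GY _ _ mA _ pA.
  have [_ OT] := related_U nO.
  have [s [s0 Hs]] := ball_in_open OT (proj1 (YU p) pY n O nw nO).
  have a0 : 0 <= a by apply: le_trans (ub _ _ pA pA); exact: (mo_ge0 rho_metric_on pY pY).
  have sa0 : 0 < s + a by lra.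
  (* the balls of radius 1 / (s + a) around the points of A are all contained
     in O, and one of them contains x *)
  have /closureE[_ /(_ (s + a)^-1)[|q [qA Dq]]] := Hx _ _ mA; first by rewrite invr_gt0.
  have qY := GY _ _ mA _ qA.
  have /(rho_near _ qY pY)[_ [_ H]] := ub _ _ qA pA.
  have [|Hqp _] := H O r _ ar; first by exists n.
  apply: (Hqp s (ltW s0) Hs x xX).
  by rewrite (mo_sym mo (YX qY) xX) mulrC -ltr_pdivlMr // mul1r.
exists x => n A nw nA; apply: contrapT => xA.
have [_ [_ [W [WT WE]]]] := Gclosed n A nw nA.
have /T'E[_ /(_ x)[|r [r0 Hr]]] := WT; first by apply/WE.
have [e [e0 He]] := rho_continuous xY r0.
have /closureE[_ /(_ e e0)[y [yA Dy]]] := Hx _ _ nA.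
have yY := GY _ _ nA _ yA.
by have /WE[] := Hr y yY (He y yY Dy).
Qed.

End Gdelta.
End Model.

Theorem theorem2p7 (M : set_structure) (hM : is_ZF_model M)
  (w : M) (hw : is_omega w)
  (K : field_data M) (hK : is_real_line K)
  (X T : M) (hX : is_Cantor_completely_metrizable w K X T)
  (Y V : M) (hY : is_Gdelta w T Y) (hV : is_subspace_topology T Y V) :
  is_Cantor_completely_metrizable w K Y V.
Proof.
have R := real_presentation hM w hK.
have [_ [d [dX TX]]] := hX; have [U [Ufun YU]] := hY.
have topV := rho_topology hM hw hK R TX dX Ufun YU hV.
split.
  exact: (metric_topology_topology hM w
    R (rho_function hM hw hK R TX dX Ufun YU) topV).
by exists (rho w R X d Y U); split; [exact: rho_complete|].
Qed.
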